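(* Let $L\geq 1$ and let $\gamma\colon \mathbb{R}\to\mathbb{R}^{2}$ be an $L$-Lipschitz mapping such that $\gamma|_{\mathbb{Z}}$ is $L$-bilipschitz. Then there exists a $40L$-bilipschitz mapping $\xi\colon\mathbb{R}\to\mathbb{R}^2$ such that $\|\gamma-\xi\|_\infty\leq 8L^5$.
   Context: $\mathbb{R}^2$ carries the Euclidean norm $\|\cdot\|$. For $A\subseteq\mathbb{R}$ and $M\geq 1$, a mapping $g\colon A\to\mathbb{R}^2$ is $M$-Lipschitz if $\|g(s)-g(t)\|\leq M|s-t|$ for all $s,t\in A$, and $M$-bilipschitz if moreover $\|g(s)-g(t)\|\geq \frac{1}{M}|s-t|$ for all $s,t\in A$. The supremum norm is $\|\gamma-\xi\|_\infty:=\sup_{t\in\mathbb{R}}\|\gamma(t)-\xi(t)\|$. *)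

(* Defs.v *)
From Stdlib Require Import Reals Lra ZArith.
From Coquelicot Require Import Coquelicot.
Open Scope R_scope.

(* Coquelicot's [norm] on the product [R * R] is the Euclidean norm. *)
Lemma norm_R2E (p : R * R) : norm p = sqrt (fst p ^ 2 + snd p ^ 2).
Proof.
change (norm p) with (sqrt (Rabs (fst p) ^ 2 + Rabs (snd p) ^ 2)).
now rewrite !pow2_abs.
Qed.

Definition lipschitz_on (M : R) (A : R -> Prop) (g : R -> R * R) : Prop :=
  forall s t : R, A s -> A t -> norm (minus (g s) (g t)) <= M * Rabs (s - t).

Definition bilipschitz_on (M : R) (A : R -> Prop) (g : R -> R * R) : Prop :=
  lipschitz_on M A g /\
  forall s t : R, A s -> A t -> / M * Rabs (s - t) <= norm (minus (g s) (g t)).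

Definition whole_line : R -> Prop := fun _ => True.

Definition integers : R -> Prop := fun x => exists n : Z, x = IZR n.

(* The supremum is taken in [Rbar]: an unbounded difference has distance
   [p_infty]. *)
Definition sup_dist (f g : R -> R * R) : Rbar :=
  Lub_Rbar (fun d => exists t : R, d = norm (minus (f t) (g t))).

(* Main.v *)
Require Import Defs.
From Stdlib Require Import Reals Lra Lia ZArith IndefiniteDescription Classical.
From Coquelicot Require Import Coquelicot.
Open Scope R_scope.

(** The curve [gamma] is replaced by a simple path in the square grid of mesh [L].

    Since [gamma] is [L]-bilipschitz on the integers and [L]-Lipschitz, times
    [s], [t] satisfy [|s - t| <= L * |gamma s - gamma t| + L ^ 2 + 1]
    ([time_le_dist]): [gamma] can come back near a point only within a time of
    order [L ^ 2], but there it may cross itself.  Rounding [gamma] down to the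
    grid at the multiples of [1 / 2], one coordinate at a time, yields a
    walk [lattice_walk] on the grid which at each step stays put or crosses one
    edge, stays within [3 * L] of [gamma], and inherits the estimate above with
    [8 * L ^ 2] as additive constant ([lattice_walk_time]).

    In particular the walk returns to a vertex only within a bounded time, so
    its loops can be erased ([loop_erased_line]): forwards one keeps last
    visits, backwards first visits, and the two rays are glued at the last
    vertex of the forward ray that lies on the backward ray.  The result is an
    injective bi-infinite grid path whose vertices keep their times in the walk.

    Let [xi] run through this path, affinely between the retained times.  These
    are at least [1 / 2] apart, so [xi] is [2 * L]-Lipschitz.  They are at most
    [9 * L ^ 2] apart ([gap_le]), so [xi] has speed at least [1 / (9 * L)] on
    every edge; consecutive edges meet at a right or straight angle, which costs
    a factor 2 at most.  Edges of an injective grid path without common endpoint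
    are at distance at least [L] ([edges_far]), and then the time estimate gives
    the lower bound, as its additive term of order [L ^ 2] is at most a constant
    times [L] times the distance.  Finally, comparing [xi s] with [gamma s]
    through the vertices before and after time [s], and averaging, gives
    [|gamma s - xi s| <= (7 * L + 9 * L ^ 3) / 2 <= 8 * L ^ 5]. *)

(** * Distances in the plane *)

Local Notation dist p q := (norm (minus p q)).

Lemma dist_R2E (p q : R * R) :
  dist p q = sqrt ((fst p - fst q) ^ 2 + (snd p - snd q) ^ 2).
Proof. exact (norm_R2E (minus p q)). Qed.

Lemma dist_sym (p q : R * R) : dist p q = dist q p.
Proof. rewrite !dist_R2E. f_equal. ring. Qed.

Lemma dist_triangle (p q r : R * R) : dist p r <= dist p q + dist q r.
Proof.
rewrite (minus_trans q). apply @norm_triangle.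
Qed.

Lemma Rabs_fst_le_dist (p q : R * R) : Rabs (fst p - fst q) <= dist p q.
Proof.
rewrite dist_R2E, <- (sqrt_pow2 (Rabs _)) by apply Rabs_pos.
apply sqrt_le_1_alt. rewrite pow2_abs. pose proof (pow2_ge_0 (snd p - snd q)). lra.
Qed.

Lemma Rabs_snd_le_dist (p q : R * R) : Rabs (snd p - snd q) <= dist p q.
Proof.
rewrite dist_R2E, <- (sqrt_pow2 (Rabs _)) by apply Rabs_pos.
apply sqrt_le_1_alt. rewrite pow2_abs. pose proof (pow2_ge_0 (fst p - fst q)). lra.
Qed.

Lemma dist_le_sum (p q : R * R) :
  dist p q <= Rabs (fst p - fst q) + Rabs (snd p - snd q).
Proof.
pose proof (Rabs_pos (fst p - fst q)) as Hx.
pose proof (Rabs_pos (snd p - snd q)) as Hy.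
rewrite dist_R2E, <- (sqrt_pow2 (Rabs _ + Rabs _)) by lra.
apply sqrt_le_1_alt. rewrite <- (pow2_abs (fst p - fst q)), <- (pow2_abs (snd p - snd q)).
nra.
Qed.

(** * Loop erasure of a bi-infinite walk *)

Lemma Z_bounded_max (P : Z -> Prop) (B k0 : Z) :
  (forall k, P k -> (k <= B)%Z) -> P k0 ->
  exists k, P k /\ forall j, P j -> (j <= k)%Z.
Proof.
intros HB.
enough (H : forall (n : nat) (k : Z), P k -> (B - k <= Z.of_nat n)%Z ->
  exists k, P k /\ forall j, P j -> (j <= k)%Z).
{ intros Hk0. apply (H (Z.to_nat (B - k0)) k0 Hk0). lia. }
induction n as [|n IH]; intros k Hk Hn.
- exists k. split; [exact Hk|]. intros j Hj. apply HB in Hj. lia.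
- destruct (classic (exists j, P j /\ (k < j)%Z)) as [[j [Hj Hkj]]|Hno].
  + apply (IH j Hj). lia.
  + exists k. split; [exact Hk|]. intros j Hj.
    destruct (Z_le_gt_dec j k) as [|Hgt]; [assumption|].
    exfalso. apply Hno. exists j. split; [exact Hj|lia].
Qed.

Lemma nat_increasing_lt (f : nat -> Z) :
  (forall n, (f n < f (S n))%Z) -> forall m n, (m < n)%nat -> (f m < f n)%Z.
Proof.
intros Hf m n Hmn. induction Hmn as [|n Hmn IH]; [apply Hf|].
pose proof (Hf n). lia.
Qed.

Lemma nat_increasing_ge (f : nat -> Z) :
  (0 <= f O)%Z -> (forall n, (f n < f (S n))%Z) -> forall n, (Z.of_nat n <= f n)%Z.
Proof.
intros H0 Hf n. induction n as [|n IH]; [exact H0|]. pose proof (Hf n). lia.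
Qed.

(** Every index [f n] is the last visit of the walk to its vertex: [f (S n)] is
    the last visit to the vertex that follows [f n]. *)
Lemma loop_erased_ray (V : Type) (v : Z -> V) (K : Z) :
  (forall i j, v i = v j -> (Z.abs (i - j) <= K)%Z) ->
  exists f : nat -> Z,
    (0 <= f O)%Z /\ v (f O) = v 0%Z /\
    (forall n, (f n < f (S n))%Z) /\
    (forall n, v (f (S n)) = v (f n + 1)%Z) /\
    (forall m n, v (f m) = v (f n) -> m = n).
Proof.
intros HK.
assert (Hlast : forall i, exists j,
  v j = v i /\ forall j', v j' = v i -> (j' <= j)%Z).
{ intros i. apply (Z_bounded_max (fun j => v j = v i) (i + K) i); [|reflexivity].
  intros j Hj. apply HK in Hj. lia. }
destruct (functional_choice _ Hlast) as [last Hl].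
set (f := fix f n := match n with O => last 0%Z | S n => last (f n + 1)%Z end).
assert (Hinc : forall n, (f n < f (S n))%Z).
{ intros n. simpl. pose proof (proj2 (Hl (f n + 1)%Z) _ eq_refl). lia. }
assert (Hmax : forall n j, v j = v (f n) -> (j <= f n)%Z).
{ intros [|n] j Hj; simpl in *;
  [destruct (Hl 0%Z) as [E M]|destruct (Hl (f n + 1)%Z) as [E M]];
  apply M; congruence. }
exists f. repeat split.
- exact (proj2 (Hl 0%Z) 0%Z eq_refl).
- exact (proj1 (Hl 0%Z)).
- exact Hinc.
- intros n. exact (proj1 (Hl (f n + 1)%Z)).
- intros m n E.
  pose proof (Hmax n _ E). symmetry in E. pose proof (Hmax m _ E).
  destruct (Nat.lt_trichotomy m n) as [Hlt|[Heq|Hlt]]; [|exact Heq|];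
  apply (nat_increasing_lt f Hinc) in Hlt; lia.
Qed.

(** A walk that returns to a vertex only within time [K] has a bi-infinite simple
    subpath, with increasing indices [w] and steps taken from the relation [E]. *)
Lemma loop_erased_line (V : Type) (E : V -> V -> Prop) (v : Z -> V) (K : Z) :
  (forall x y, E x y -> E y x) ->
  (forall i, v i = v (i + 1)%Z \/ E (v i) (v (i + 1)%Z)) ->
  (forall i j, v i = v j -> (Z.abs (i - j) <= K)%Z) ->
  exists w : Z -> Z,
    (forall k, (w k < w (k + 1))%Z) /\
    (forall k, E (v (w k)) (v (w (k + 1)%Z))) /\
    (forall k l, v (w k) = v (w l) -> k = l).
Proof.
intros Esym Hstep HK.
destruct (loop_erased_ray V v K HK) as [f [f0 [fv [finc [fstep finj]]]]].
(* The reversed walk: last visits become first visits. *)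
destruct (loop_erased_ray V (fun i => v (- i)%Z) K) as [g [g0 [gv [ginc [gstep ginj]]]]].
{ intros i j Hij. apply HK in Hij. lia. }
simpl in gv.
pose proof (nat_increasing_ge f f0 finc) as fge.
pose proof (nat_increasing_ge g g0 ginc) as gge.
(* [a] is the last position of the forward ray [f] at a vertex of the backward ray
   [g]; there the two rays are glued, so that they share no further vertex. *)
destruct (Z_bounded_max
  (fun a => exists b : nat, v (f (Z.to_nat a)) = v (- g b)%Z /\ (0 <= a)%Z) K 0%Z)
  as [a [[b [Hab Ha]] Hmax]].
{ intros a [b [Hab Ha]]. apply HK in Hab.
  pose proof (fge (Z.to_nat a)). pose proof (gge b). lia. }
{ exists O. split; [|lia]. rewrite gv. exact fv. }
set (w := fun k => if Z_le_gt_dec 0 k then f (Z.to_nat (a + k))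
                   else (- g (b + Z.to_nat (- k))%nat)%Z).
assert (fE : forall n, E (v (f n)) (v (f (S n)))).
{ intros n. rewrite fstep. destruct (Hstep (f n)) as [H|H]; [|exact H].
  exfalso. rewrite <- fstep in H. apply finj in H. lia. }
assert (gE : forall n, E (v (- g (S n))%Z) (v (- g n)%Z)).
{ intros n. rewrite gstep. destruct (Hstep (- (g n + 1))%Z) as [H|H];
  replace (- (g n + 1) + 1)%Z with (- g n)%Z in H by lia; [|exact H].
  exfalso. rewrite <- gstep in H. apply ginj in H. lia. }
assert (Hcross : forall k l, (0 <= k)%Z -> (l < 0)%Z ->
  v (f (Z.to_nat (a + k))) <> v (- g (b + Z.to_nat (- l))%nat)%Z).
{ intros k l Hk Hl H.
  destruct (Z.eq_dec k 0) as [->|Hk0].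
  - rewrite Z.add_0_r, Hab in H. apply ginj in H. lia.
  - assert (a + k <= a)%Z; [|lia].
    apply Hmax. eexists. split; [exact H|lia]. }
exists w. repeat split.
- intros k. unfold w.
  destruct (Z_le_gt_dec 0 k), (Z_le_gt_dec 0 (k + 1)); try lia.
  + replace (Z.to_nat (a + (k + 1))) with (S (Z.to_nat (a + k))) by lia. apply finc.
  + pose proof (fge (Z.to_nat (a + (k + 1)))).
    pose proof (gge (b + Z.to_nat (- k))%nat). lia.
  + replace (b + Z.to_nat (- k))%nat with (S (b + Z.to_nat (- (k + 1))))%nat by lia.
    pose proof (ginc (b + Z.to_nat (- (k + 1)))%nat). lia.
- intros k. unfold w.
  destruct (Z_le_gt_dec 0 k), (Z_le_gt_dec 0 (k + 1)); try lia.
  + replace (Z.to_nat (a + (k + 1))) with (S (Z.to_nat (a + k))) by lia. apply fE.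
  + replace (a + (k + 1))%Z with a by lia. rewrite Hab.
    replace (b + Z.to_nat (- k))%nat with (S b) by lia. apply gE.
  + replace (b + Z.to_nat (- k))%nat with (S (b + Z.to_nat (- (k + 1))))%nat by lia.
    apply gE.
- intros k l. unfold w.
  destruct (Z_le_gt_dec 0 k), (Z_le_gt_dec 0 l); intros H.
  + apply finj in H. lia.
  + exfalso. revert H. apply Hcross; lia.
  + exfalso. symmetry in H. revert H. apply Hcross; lia.
  + apply ginj in H. lia.
Qed.

(** * Edges of the square lattice *)

(** The grid vertices [v] and [w] are the endpoints of an edge of [Z * Z]. *)
Definition adjacent (v w : Z * Z) : Prop :=
  (Z.abs (fst v - fst w) + Z.abs (snd v - snd w) = 1)%Z.

(** The vertex [v] in the grid of mesh [h]. *)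
Definition lattice_point (h : R) (v : Z * Z) : R * R :=
  (h * IZR (fst v), h * IZR (snd v)).

(** The point [(1 - a) * v + a * w] of the edge from [v] to [w], in the grid of
    mesh [h]. *)
Definition edge_point (h : R) (v w : Z * Z) (a : R) : R * R :=
  (h * (IZR (fst v) + a * (IZR (fst w) - IZR (fst v))),
   h * (IZR (snd v) + a * (IZR (snd w) - IZR (snd v)))).

Lemma edge_point_0 h v w : edge_point h v w 0 = lattice_point h v.
Proof. unfold edge_point, lattice_point. f_equal; ring. Qed.

Lemma edge_point_1 h v w : edge_point h v w 1 = lattice_point h w.
Proof. unfold edge_point, lattice_point. f_equal; ring. Qed.

Lemma adjacent_sym v w : adjacent v w -> adjacent w v.
Proof. unfold adjacent. lia. Qed.

Lemma adjacent_cases v w : adjacent v w ->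
  (fst w = fst v + 1 /\ snd w = snd v)%Z \/ (fst w = fst v - 1 /\ snd w = snd v)%Z \/
  (fst w = fst v /\ snd w = snd v + 1)%Z \/ (fst w = fst v /\ snd w = snd v - 1)%Z.
Proof. unfold adjacent. lia. Qed.

Lemma edge_dist_le h v w a b : 0 <= h -> adjacent v w ->
  dist (edge_point h v w a) (edge_point h v w b) <= h * Rabs (a - b).
Proof.
intros Hh Hvw. eapply Rle_trans; [apply dist_le_sum|]. simpl.
apply Req_le.
apply adjacent_cases in Hvw.
destruct Hvw as [[-> ->]|[[-> ->]|[[-> ->]|[-> ->]]]];
rewrite ?plus_IZR, ?minus_IZR;
rewrite <- !Rmult_minus_distr_l, !Rabs_mult, (Rabs_pos_eq h Hh), <- Rmult_plus_distr_l;
f_equal; unfold Rabs; repeat destruct Rcase_abs; lra.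
Qed.

Lemma edge_coord_le_dist h u u' v v' a b : 0 <= h ->
  let p := edge_point 1 u u' a in let q := edge_point 1 v v' b in
  h * Rabs (fst p - fst q) <= dist (edge_point h u u' a) (edge_point h v v' b) /\
  h * Rabs (snd p - snd q) <= dist (edge_point h u u' a) (edge_point h v v' b).
Proof.
intros Hh p q.
pose proof (Rabs_fst_le_dist (edge_point h u u' a) (edge_point h v v' b)) as H1.
pose proof (Rabs_snd_le_dist (edge_point h u u' a) (edge_point h v v' b)) as H2.
simpl in *.
rewrite <- Rmult_minus_distr_l, Rabs_mult, (Rabs_pos_eq h Hh) in H1, H2.
now rewrite !Rmult_1_l.
Qed.

Lemma edge_dist_ge h v w a b : 0 <= h -> adjacent v w ->
  h * Rabs (a - b) <= dist (edge_point h v w a) (edge_point h v w b).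
Proof.
intros Hh Hvw.
destruct (edge_coord_le_dist h v w v w a b Hh) as [H1 H2]. simpl in H1, H2.
assert (H : Rabs (a - b) <=
  Rabs (1 * (IZR (fst v) + a * (IZR (fst w) - IZR (fst v))) -
        1 * (IZR (fst v) + b * (IZR (fst w) - IZR (fst v)))) \/
  Rabs (a - b) <=
  Rabs (1 * (IZR (snd v) + a * (IZR (snd w) - IZR (snd v))) -
        1 * (IZR (snd v) + b * (IZR (snd w) - IZR (snd v))))).
{ apply adjacent_cases in Hvw.
  destruct Hvw as [[-> ->]|[[-> ->]|[[-> ->]|[-> ->]]]];
  [left | left | right | right];
  rewrite ?plus_IZR, ?minus_IZR; unfold Rabs; repeat destruct Rcase_abs; lra. }
destruct H as [H|H]; apply (Rmult_le_compat_l h _ _ Hh) in H; lra.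
Qed.

Lemma integer_intervals_gap (x x' y y' : Z) (a b : R) :
  (Z.max x x' < Z.min y y')%Z -> 0 <= a <= 1 -> 0 <= b <= 1 ->
  1 <= IZR y + b * (IZR y' - IZR y) - (IZR x + a * (IZR x' - IZR x)).
Proof.
intros Hlt Ha Hb. set (m := Z.max x x').
assert (Hx : IZR x <= IZR m) by (apply IZR_le; lia).
assert (Hx' : IZR x' <= IZR m) by (apply IZR_le; lia).
assert (Hy : IZR m + 1 <= IZR y) by (rewrite <- plus_IZR; apply IZR_le; lia).
assert (Hy' : IZR m + 1 <= IZR y') by (rewrite <- plus_IZR; apply IZR_le; lia).
nra.
Qed.

(** Two edges without common endpoint: the bounding boxes are degenerate, so a
    common lattice point would be a common endpoint; hence the boxes are disjoint,
    and, having integer corners, they are a mesh width apart in some coordinate. *)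
Lemma edges_far h u u' v v' a b : 0 <= h -> adjacent u u' -> adjacent v v' ->
  u <> v -> u <> v' -> u' <> v -> u' <> v' -> 0 <= a <= 1 -> 0 <= b <= 1 ->
  h <= dist (edge_point h u u' a) (edge_point h v v' b).
Proof.
intros Hh Hu Hv n1 n2 n3 n4 Ha Hb.
destruct (edge_coord_le_dist h u u' v v' a b Hh) as [H1 H2]. simpl in H1, H2.
assert (Hsep : (Z.max (fst u) (fst u') < Z.min (fst v) (fst v') \/
  Z.max (fst v) (fst v') < Z.min (fst u) (fst u') \/
  Z.max (snd u) (snd u') < Z.min (snd v) (snd v') \/
  Z.max (snd v) (snd v') < Z.min (snd u) (snd u'))%Z).
{ destruct u as [x1 y1], u' as [x2 y2], v as [x3 y3], v' as [x4 y4].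
  unfold adjacent in *; simpl in *.
  assert (N1 : ~ (x1 = x3 /\ y1 = y3)%Z) by (intros [-> ->]; auto).
  assert (N2 : ~ (x1 = x4 /\ y1 = y4)%Z) by (intros [-> ->]; auto).
  assert (N3 : ~ (x2 = x3 /\ y2 = y3)%Z) by (intros [-> ->]; auto).
  assert (N4 : ~ (x2 = x4 /\ y2 = y4)%Z) by (intros [-> ->]; auto).
  clear - Hu Hv N1 N2 N3 N4. lia. }
destruct Hsep as [S|[S|[S|S]]];
[ pose proof (integer_intervals_gap _ _ _ _ a b S Ha Hb)
| pose proof (integer_intervals_gap _ _ _ _ b a S Hb Ha)
| pose proof (integer_intervals_gap _ _ _ _ a b S Ha Hb)
| pose proof (integer_intervals_gap _ _ _ _ b a S Hb Ha) ];
[ eapply Rle_trans; [|exact H1] | eapply Rle_trans; [|exact H1]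
| eapply Rle_trans; [|exact H2] | eapply Rle_trans; [|exact H2] ];
rewrite <- (Rmult_1_r h) at 1; apply Rmult_le_compat_l; try exact Hh;
rewrite !Rmult_1_l; unfold Rabs; destruct Rcase_abs; lra.
Qed.

(** Two edges that share [v] only form a right or straight angle there, so the
    distance of two points is comparable with the path length between them. *)
Lemma edges_consecutive h u v w a b : 0 <= h -> adjacent u v -> adjacent v w ->
  u <> w -> 0 <= a <= 1 -> 0 <= b <= 1 ->
  h * ((1 - a) + b) <= 2 * dist (edge_point h u v a) (edge_point h v w b).
Proof.
intros Hh Hu Hw Huw Ha Hb.
destruct (edge_coord_le_dist h u v v w a b Hh) as [H1 H2]. simpl in H1, H2.
enough (H : (1 - a) + b <=
  Rabs (1 * (IZR (fst u) + a * (IZR (fst v) - IZR (fst u))) -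
        1 * (IZR (fst v) + b * (IZR (fst w) - IZR (fst v)))) +
  Rabs (1 * (IZR (snd u) + a * (IZR (snd v) - IZR (snd u))) -
        1 * (IZR (snd v) + b * (IZR (snd w) - IZR (snd v))))).
{ apply (Rmult_le_compat_l h _ _ Hh) in H. lra. }
clear H1 H2.
apply adjacent_sym, adjacent_cases in Hu. apply adjacent_cases in Hw.
destruct u as [x1 y1], v as [x2 y2], w as [x3 y3]. simpl in *.
destruct Hu as [[-> ->]|[[-> ->]|[[-> ->]|[-> ->]]]];
destruct Hw as [[-> ->]|[[-> ->]|[[-> ->]|[-> ->]]]];
try (exfalso; apply Huw; reflexivity);
rewrite ?plus_IZR, ?minus_IZR; unfold Rabs; repeat destruct Rcase_abs; lra.
Qed.

(** * The piecewise linear curve through a lattice path *)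

(** An injective path [v] of grid vertices, visited at the times [t]. *)
Section LatticePath.

Variables (L : R) (v : Z -> Z * Z) (t : Z -> R).
Hypothesis (HL : 1 <= L).
Hypothesis (v_adj : forall k, adjacent (v k) (v (k + 1)%Z)).
Hypothesis (v_inj : forall k l, v k = v l -> k = l).
Hypothesis (t_step : forall k, 1 / 2 <= t (k + 1)%Z - t k).
Hypothesis (t_dist : forall k m, t m - t k <=
  L * dist (lattice_point L (v k)) (lattice_point L (v m)) + 8 * L ^ 2).

(** At time [s] the piecewise affine curve through the vertices [v] is at [p], on
    the edge number [k], a fraction [a] of which has been covered.  As [a < 1], the
    edge is the one that begins in case [s] is the time of a vertex. *)
Definition on_path (s : R) (k : Z) (a : R) (p : R * R) : Prop :=
  0 <= a < 1 /\ s = t k + a * (t (k + 1)%Z - t k) /\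
  p = edge_point L (v k) (v (k + 1)%Z) a.

Lemma t_growth (k : Z) (n : nat) : INR n / 2 <= t (k + Z.of_nat n)%Z - t k.
Proof.
induction n as [|n IH].
- simpl. rewrite Z.add_0_r. lra.
- rewrite S_INR. replace (k + Z.of_nat (S n))%Z with (k + Z.of_nat n + 1)%Z by lia.
  pose proof (t_step (k + Z.of_nat n)%Z). lra.
Qed.

Lemma t_growth_Z (k m : Z) : (k <= m)%Z -> IZR (m - k) / 2 <= t m - t k.
Proof.
intros H. pose proof (t_growth k (Z.to_nat (m - k))) as G.
rewrite INR_IZR_INZ, Z2Nat.id in G by lia.
replace (k + (m - k))%Z with m in G by lia. exact G.
Qed.

Lemma t_mono (k m : Z) : (k <= m)%Z -> t k <= t m.
Proof.
intros H. pose proof (t_growth_Z k m H) as G.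
assert (0 <= IZR (m - k)) by (apply IZR_le; lia). lra.
Qed.

Lemma on_path_exists (s : R) : exists k a p, on_path s k a p.
Proof.
destruct (archimed (2 * Rabs (s - t 0%Z))) as [HN _].
set (N := up (2 * Rabs (s - t 0%Z))) in *.
assert (HN0 : (0 <= N)%Z).
{ apply le_IZR. pose proof (Rabs_pos (s - t 0%Z)). lra. }
assert (Hup : s - t 0%Z <= Rabs (s - t 0%Z)) by apply Rle_abs.
assert (Hlo : - (s - t 0%Z) <= Rabs (s - t 0%Z))
  by (rewrite <- Rabs_Ropp; apply Rle_abs).
destruct (Z_bounded_max (fun k => t k <= s) N (- N)%Z) as [k [Hk Hmax]].
{ intros k Hk. destruct (Z_le_gt_dec k N) as [|Hgt]; [assumption|exfalso].
  pose proof (t_growth_Z 0 k ltac:(lia)) as G.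
  assert (IZR N <= IZR (k - 0)) by (apply IZR_le; lia). lra. }
{ pose proof (t_growth_Z (- N) 0 ltac:(lia)) as G.
  replace (0 - - N)%Z with N in G by lia. lra. }
assert (Hk1 : s < t (k + 1)%Z).
{ apply Rnot_le_lt. intros H. apply Hmax in H. lia. }
pose proof (t_step k) as Hg.
exists k, ((s - t k) / (t (k + 1)%Z - t k)). eexists. split; [|split; [|reflexivity]].
- split.
  + apply Rdiv_le_0_compat; lra.
  + apply Rlt_div_l; lra.
- field. lra.
Qed.

Lemma gap_le (k : Z) : t (k + 1)%Z - t k <= 9 * L ^ 2.
Proof.
eapply Rle_trans; [apply t_dist|].
rewrite <- (edge_point_0 L (v k) (v (k + 1)%Z)), <- (edge_point_1 L (v k) (v (k + 1)%Z)).
pose proof (edge_dist_le L _ _ 0 1 ltac:(lra) (v_adj k)) as H.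
replace (Rabs (0 - 1)) with 1 in H by (unfold Rabs; destruct Rcase_abs; lra).
nra.
Qed.

Lemma lattice_points_lipschitz (k m : Z) : (k <= m)%Z ->
  dist (lattice_point L (v k)) (lattice_point L (v m)) <= 2 * L * (t m - t k).
Proof.
intros Hkm. replace m with (k + Z.of_nat (Z.to_nat (m - k)))%Z by lia.
generalize (Z.to_nat (m - k)). clear m Hkm. intros n. induction n as [|n IH].
- rewrite Z.add_0_r, dist_R2E, !Rminus_diag.
  replace (0 ^ 2 + 0 ^ 2) with 0 by ring. rewrite sqrt_0. lra.
- replace (k + Z.of_nat (S n))%Z with (k + Z.of_nat n + 1)%Z by lia.
  set (j := (k + Z.of_nat n)%Z) in *.
  eapply Rle_trans; [apply (dist_triangle _ (lattice_point L (v j)))|].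
  pose proof (edge_dist_le L _ _ 0 1 ltac:(lra) (v_adj j)) as H.
  rewrite edge_point_0, edge_point_1 in H.
  replace (Rabs (0 - 1)) with 1 in H by (unfold Rabs; destruct Rcase_abs; lra).
  pose proof (t_step j). nra.
Qed.

Lemma on_path_start s k a p : on_path s k a p ->
  dist (lattice_point L (v k)) p <= L * a.
Proof.
intros [Ha [_ ->]]. rewrite <- (edge_point_0 L (v k) (v (k + 1)%Z)).
eapply Rle_trans; [apply edge_dist_le; [lra|apply v_adj]|].
apply Rmult_le_compat_l; [lra|]. unfold Rabs; destruct Rcase_abs; lra.
Qed.

Lemma on_path_end s k a p : on_path s k a p ->
  dist p (lattice_point L (v (k + 1)%Z)) <= L * (1 - a).
Proof.
intros [Ha [_ ->]]. rewrite <- (edge_point_1 L (v k) (v (k + 1)%Z)).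
eapply Rle_trans; [apply edge_dist_le; [lra|apply v_adj]|].
apply Rmult_le_compat_l; [lra|]. unfold Rabs; destruct Rcase_abs; lra.
Qed.

Lemma on_path_order s k a p s' m b q : on_path s k a p -> on_path s' m b q ->
  s <= s' -> (k <= m)%Z.
Proof.
intros [Ha [-> _]] [Hb [-> _]] H.
destruct (Z_le_gt_dec k m) as [|Hgt]; [assumption|exfalso].
pose proof (t_mono (m + 1) k ltac:(lia)).
pose proof (t_step k). pose proof (t_step m). nra.
Qed.

Lemma on_path_lipschitz s k a p s' m b q : on_path s k a p -> on_path s' m b q ->
  s <= s' -> dist p q <= 2 * L * (s' - s).
Proof.
intros Hp Hq Hs. pose proof (on_path_order _ _ _ _ _ _ _ _ Hp Hq Hs) as Hkm.
pose proof (on_path_end _ _ _ _ Hp) as Ep. pose proof (on_path_start _ _ _ _ Hq) as Eq.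
destruct Hp as [Ha [Es Hp]], Hq as [Hb [Es' Hq]].
pose proof (t_step k) as Gk. pose proof (t_step m) as Gm.
destruct (Z.eq_dec k m) as [<-|Hne].
- assert (Hab : a <= b) by nra.
  rewrite Hp, Hq. eapply Rle_trans; [apply edge_dist_le; [lra|apply v_adj]|].
  replace (Rabs (a - b)) with (b - a) by (unfold Rabs; destruct Rcase_abs; lra).
  replace (s' - s) with ((b - a) * (t (k + 1)%Z - t k)) by (subst; ring).
  assert ((b - a) * (1 / 2) <= (b - a) * (t (k + 1)%Z - t k))
    by (apply Rmult_le_compat_l; lra). nra.
- pose proof (lattice_points_lipschitz (k + 1) m ltac:(lia)) as Em.
  pose proof (dist_triangle p (lattice_point L (v (k + 1)%Z)) q) as T1.
  pose proof (dist_triangle (lattice_point L (v (k + 1)%Z)) (lattice_point L (v m)) q) as T2.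
  assert (H1 : (1 - a) * (1 / 2) <= t (k + 1)%Z - s).
  { replace (t (k + 1)%Z - s) with ((1 - a) * (t (k + 1)%Z - t k)) by (subst; ring).
    apply Rmult_le_compat_l; lra. }
  assert (H2 : b * (1 / 2) <= s' - t m).
  { replace (s' - t m) with (b * (t (m + 1)%Z - t m)) by (subst; ring).
    apply Rmult_le_compat_l; lra. }
  apply (Rmult_le_compat_l (2 * L)) in H1; [|lra].
  apply (Rmult_le_compat_l (2 * L)) in H2; [|lra].
  lra.
Qed.

(** The cases are: same edge, consecutive edges, edges without common endpoint.  In
    the last one, [dist p q >= L] absorbs the additive constant of [t_dist]. *)
Lemma on_path_expanding s k a p s' m b q : on_path s k a p -> on_path s' m b q ->
  s <= s' -> s' - s <= 18 * L * dist p q.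
Proof.
intros Hp Hq Hs. pose proof (on_path_order _ _ _ _ _ _ _ _ Hp Hq Hs) as Hkm.
pose proof (on_path_start _ _ _ _ Hp) as Ep. pose proof (on_path_end _ _ _ _ Hq) as Eq.
destruct Hp as [Ha [Es Hp]], Hq as [Hb [Es' Hq]].
pose proof (t_step k) as Gk. pose proof (t_step m) as Gm.
pose proof (gap_le k) as Uk. pose proof (gap_le m) as Um.
assert (Hcase : k = m \/ m = (k + 1)%Z \/ (k + 2 <= m)%Z) by lia.
destruct Hcase as [<-|[->|Hfar]].
- assert (Hab : a <= b) by nra.
  pose proof (edge_dist_ge L _ _ a b ltac:(lra) (v_adj k)) as D.
  rewrite <- Hp, <- Hq in D.
  replace (Rabs (a - b)) with (b - a) in D by (unfold Rabs; destruct Rcase_abs; lra).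
  replace (s' - s) with ((b - a) * (t (k + 1)%Z - t k)) by (subst; ring).
  apply Rle_trans with ((b - a) * (9 * L ^ 2)); [apply Rmult_le_compat_l; lra|].
  nra.
- assert (Hne : v k <> v (k + 1 + 1)%Z) by (intros E; apply v_inj in E; lia).
  pose proof (edges_consecutive L _ _ _ a b ltac:(lra) (v_adj k) (v_adj (k + 1)%Z) Hne
    ltac:(lra) ltac:(lra)) as D.
  rewrite <- Hp, <- Hq in D.
  replace (s' - s) with ((1 - a) * (t (k + 1)%Z - t k) +
    b * (t (k + 1 + 1)%Z - t (k + 1)%Z)) by (subst; ring).
  apply Rle_trans with ((1 - a) * (9 * L ^ 2) + b * (9 * L ^ 2)).
  { apply Rplus_le_compat; apply Rmult_le_compat_l; lra. }
  nra.
- assert (D : L <= dist p q).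
  { rewrite Hp, Hq. apply edges_far; try apply v_adj; try lra;
    intros E; apply v_inj in E; lia. }
  pose proof (t_dist k (m + 1)%Z) as T.
  pose proof (dist_triangle (lattice_point L (v k)) p (lattice_point L (v (m + 1)%Z))) as T1.
  pose proof (dist_triangle p q (lattice_point L (v (m + 1)%Z))) as T2.
  assert (H : s' - s <= t (m + 1)%Z - t k) by (subst; nra).
  assert (H2 : dist (lattice_point L (v k)) (lattice_point L (v (m + 1)%Z)) <=
    dist p q + 2 * L) by nra.
  apply (Rmult_le_compat_l L) in H2; [|lra]. nra.
Qed.

End LatticePath.

(** * Sampling the curve *)

(** The integer part of [x / h]: the index of the cell of width [h] containing
    [x]. *)
Definition floor_div (h x : R) : Z := Int_part (x / h).

Lemma floor_div_bounds (h x : R) : 0 < h ->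
  h * IZR (floor_div h x) <= x < h * IZR (floor_div h x) + h.
Proof.
intros Hh. unfold floor_div. destruct (base_Int_part (x / h)) as [H1 H2].
assert (E : x = h * (x / h)) by (field; lra).
split.
- rewrite E at 2. apply Rmult_le_compat_l; lra.
- rewrite E at 1. replace (h * IZR (Int_part (x / h)) + h)
    with (h * (IZR (Int_part (x / h)) + 1)) by ring.
  apply Rmult_lt_compat_l; lra.
Qed.

Lemma floor_div_step (h x y : R) : 0 < h -> Rabs (x - y) <= h ->
  (Z.abs (floor_div h x - floor_div h y) <= 1)%Z.
Proof.
intros Hh Hxy. pose proof (floor_div_bounds h x Hh). pose proof (floor_div_bounds h y Hh).
assert (Hx : x - y <= h) by (eapply Rle_trans; [apply Rle_abs|exact Hxy]).
assert (Hy : y - x <= h)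
  by (eapply Rle_trans; [apply Rle_abs|]; rewrite Rabs_minus_sym; exact Hxy).
assert (H1 : IZR (floor_div h x) < IZR (floor_div h y + 2)).
{ rewrite plus_IZR. apply (Rmult_lt_reg_l h); [exact Hh|]. lra. }
assert (H2 : IZR (floor_div h y) < IZR (floor_div h x + 2)).
{ rewrite plus_IZR. apply (Rmult_lt_reg_l h); [exact Hh|]. lra. }
apply lt_IZR in H1. apply lt_IZR in H2. lia.
Qed.

(** The vertex at index [i], which stands for the time [i / 2], has as coordinates
    those of [gamma], rounded down to the grid, at the integer [i / 2] rounded up
    for the first coordinate and rounded down for the second.  Thus the two
    coordinates never change at the same step. *)
Definition lattice_walk (L : R) (gamma : R -> R * R) (i : Z) : Z * Z :=
  (floor_div L (fst (gamma (IZR ((i + 1) / 2)))),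
   floor_div L (snd (gamma (IZR (i / 2))))).

Lemma lattice_walk_step (L : R) (gamma : R -> R * R) (i : Z) : 0 < L ->
  lipschitz_on L whole_line gamma ->
  lattice_walk L gamma i = lattice_walk L gamma (i + 1) \/
  adjacent (lattice_walk L gamma i) (lattice_walk L gamma (i + 1)).
Proof.
intros HL Hg.
assert (Hstep : forall n : Z,
  (Z.abs (floor_div L (fst (gamma (IZR n))) - floor_div L (fst (gamma (IZR (n + 1))))) <= 1)%Z /\
  (Z.abs (floor_div L (snd (gamma (IZR n))) - floor_div L (snd (gamma (IZR (n + 1))))) <= 1)%Z).
{ intros n.
  assert (D : dist (gamma (IZR n)) (gamma (IZR (n + 1))) <= L).
  { eapply Rle_trans; [apply Hg; exact I|].
    rewrite plus_IZR. replace (IZR n - (IZR n + 1)) with (- (1)) by ring.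
    rewrite Rabs_Ropp, Rabs_R1. lra. }
  split; (apply floor_div_step; [exact HL|]; eapply Rle_trans; [|exact D]).
  - apply Rabs_fst_le_dist.
  - apply Rabs_snd_le_dist. }
unfold lattice_walk.
destruct (Z.Even_or_Odd i) as [[n ->]|[n ->]].
- replace ((2 * n + 1) / 2)%Z with n by (Z.to_euclidean_division_equations; lia).
  replace ((2 * n + 1 + 1) / 2)%Z with (n + 1)%Z by (Z.to_euclidean_division_equations; lia).
  replace ((2 * n) / 2)%Z with n by (Z.to_euclidean_division_equations; lia).
  destruct (Hstep n) as [H _].
  destruct (Z.eq_dec (floor_div L (fst (gamma (IZR n))))
    (floor_div L (fst (gamma (IZR (n + 1)))))) as [->|Hne];
  [left; reflexivity|right; unfold adjacent; simpl; lia].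
- replace ((2 * n + 1) / 2)%Z with n by (Z.to_euclidean_division_equations; lia).
  replace ((2 * n + 1 + 1 + 1) / 2)%Z with (n + 1)%Z by (Z.to_euclidean_division_equations; lia).
  replace ((2 * n + 1 + 1) / 2)%Z with (n + 1)%Z by (Z.to_euclidean_division_equations; lia).
  destruct (Hstep n) as [_ H].
  destruct (Z.eq_dec (floor_div L (snd (gamma (IZR n))))
    (floor_div L (snd (gamma (IZR (n + 1)))))) as [->|Hne];
  [left; reflexivity|right; unfold adjacent; simpl; lia].
Qed.

Lemma half_div_bounds (i : Z) :
  Rabs (IZR ((i + 1) / 2) - IZR i / 2) <= 1 / 2 /\ Rabs (IZR (i / 2) - IZR i / 2) <= 1 / 2.
Proof.
assert (H1 : (i <= 2 * ((i + 1) / 2) <= i + 1)%Z)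
  by (Z.to_euclidean_division_equations; lia).
assert (H2 : (i - 1 <= 2 * (i / 2) <= i)%Z)
  by (Z.to_euclidean_division_equations; lia).
destruct H1 as [A B], H2 as [C D].
apply IZR_le in A, B, C, D. rewrite ?mult_IZR, ?plus_IZR, ?minus_IZR in *.
split; apply Rabs_le; lra.
Qed.

Lemma lattice_walk_close (L : R) (gamma : R -> R * R) (i : Z) : 0 < L ->
  lipschitz_on L whole_line gamma ->
  dist (lattice_point L (lattice_walk L gamma i)) (gamma (IZR i / 2)) <= 3 * L.
Proof.
intros HL Hg. destruct (half_div_bounds i) as [B1 B2].
eapply Rle_trans; [apply dist_le_sum|]. simpl.
set (n := ((i + 1) / 2)%Z) in *. set (m := (i / 2)%Z) in *.
pose proof (Rle_trans _ _ _ (Rabs_fst_le_dist _ _)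
  (Hg (IZR n) (IZR i / 2) I I)) as D1.
pose proof (Rle_trans _ _ _ (Rabs_snd_le_dist _ _)
  (Hg (IZR m) (IZR i / 2) I I)) as D2.
apply (Rmult_le_compat_l L) in B1, B2; try lra.
pose proof (Rle_trans _ _ _ D1 B1) as E1. pose proof (Rle_trans _ _ _ D2 B2) as E2.
apply Rabs_le_between in E1, E2.
pose proof (floor_div_bounds L (fst (gamma (IZR n))) HL).
pose proof (floor_div_bounds L (snd (gamma (IZR m))) HL).
apply Rle_trans with (3 / 2 * L + 3 / 2 * L); [|lra].
apply Rplus_le_compat; apply Rabs_le; lra.
Qed.

Lemma exists_nearest_integer (s : R) : exists n : Z, Rabs (s - IZR n) <= 1 / 2.
Proof.
exists (Int_part (s + 1 / 2)). destruct (base_Int_part (s + 1 / 2)).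
apply Rabs_le. lra.
Qed.

Lemma time_le_dist (L : R) (gamma : R -> R * R) (s t : R) : 1 <= L ->
  lipschitz_on L whole_line gamma -> bilipschitz_on L integers gamma ->
  Rabs (s - t) <= L * dist (gamma s) (gamma t) + L ^ 2 + 1.
Proof.
intros HL Hg [_ Hz].
destruct (exists_nearest_integer s) as [n Hn], (exists_nearest_integer t) as [m Hm].
pose proof (Hz (IZR n) (IZR m) (ex_intro _ n eq_refl) (ex_intro _ m eq_refl)) as B.
apply (Rmult_le_compat_l L) in B; [|lra].
rewrite <- Rmult_assoc, Rinv_r, Rmult_1_l in B by lra.
pose proof (Hg s (IZR n) I I) as D1. pose proof (Hg t (IZR m) I I) as D2.
rewrite dist_sym in D1.
pose proof (dist_triangle (gamma (IZR n)) (gamma s) (gamma (IZR m))) as T1.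
pose proof (dist_triangle (gamma s) (gamma t) (gamma (IZR m))) as T2.
assert (T3 : Rabs (s - t) <= Rabs (IZR n - IZR m) + 1).
{ apply Rabs_le_between in Hn, Hm.
  pose proof (Rle_abs (IZR n - IZR m)).
  pose proof (Rle_abs (- (IZR n - IZR m))) as X. rewrite Rabs_Ropp in X.
  apply Rabs_le. lra. }
assert (D : dist (gamma (IZR n)) (gamma (IZR m)) <= dist (gamma s) (gamma t) + L) by nra.
apply (Rmult_le_compat_l L) in D; [|lra]. nra.
Qed.

Lemma lattice_walk_time (L : R) (gamma : R -> R * R) (i j : Z) : 1 <= L ->
  lipschitz_on L whole_line gamma -> bilipschitz_on L integers gamma ->
  Rabs (IZR i / 2 - IZR j / 2) <=
    L * dist (lattice_point L (lattice_walk L gamma i))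
             (lattice_point L (lattice_walk L gamma j)) + 8 * L ^ 2.
Proof.
intros HL Hg Hz.
eapply Rle_trans; [apply (time_le_dist L gamma); assumption|].
pose proof (lattice_walk_close L gamma i ltac:(lra) Hg) as Ci.
pose proof (lattice_walk_close L gamma j ltac:(lra) Hg) as Cj.
rewrite dist_sym in Ci.
set (p := lattice_point L (lattice_walk L gamma i)) in *.
set (q := lattice_point L (lattice_walk L gamma j)) in *.
pose proof (dist_triangle (gamma (IZR i / 2)) p (gamma (IZR j / 2))) as T1.
pose proof (dist_triangle p q (gamma (IZR j / 2))) as T2.
assert (D : dist (gamma (IZR i / 2)) (gamma (IZR j / 2)) <= dist p q + 6 * L) by lra.
apply (Rmult_le_compat_l L) in D; [|lra]. nra.
Qed.

Theorem proposition3p1 (L : R) (hL : 1 <= L) (gamma : R -> R * R)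
    (hgamma : lipschitz_on L whole_line gamma)
    (hgammaZ : bilipschitz_on L integers gamma) :
  exists xi : R -> R * R,
    bilipschitz_on (40 * L) whole_line xi /\
    Rbar_le (sup_dist gamma xi) (8 * L ^ 5).
Proof.
set (u := lattice_walk L gamma).
destruct (loop_erased_line (Z * Z) adjacent u (up (16 * L ^ 2)))
  as [w [w_inc [w_adj w_inj]]].
{ exact adjacent_sym. }
{ intros i. apply lattice_walk_step; [lra|exact hgamma]. }
{ intros i j Hij. pose proof (lattice_walk_time L gamma i j hL hgamma hgammaZ) as H.
  fold u in H. rewrite Hij, dist_R2E, !Rminus_diag in H.
  replace (0 ^ 2 + 0 ^ 2) with 0 in H by ring. rewrite sqrt_0 in H.
  destruct (archimed (16 * L ^ 2)) as [A _].
  apply le_IZR. rewrite abs_IZR, minus_IZR.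
  replace (IZR i - IZR j) with (2 * (IZR i / 2 - IZR j / 2)) by lra.
  rewrite Rabs_mult, (Rabs_pos_eq 2) by lra. lra. }
set (v := fun k => u (w k)). set (t := fun k => IZR (w k) / 2).
assert (t_step : forall k, 1 / 2 <= t (k + 1)%Z - t k).
{ intros k. unfold t. assert (H : IZR (w k + 1) <= IZR (w (k + 1)%Z)).
  { apply IZR_le. pose proof (w_inc k). lia. }
  rewrite plus_IZR in H. lra. }
assert (t_dist : forall k m, t m - t k <=
  L * dist (lattice_point L (v k)) (lattice_point L (v m)) + 8 * L ^ 2).
{ intros k m. eapply Rle_trans; [apply Rle_abs|].
  rewrite Rabs_minus_sym. apply lattice_walk_time; assumption. }
assert (Hxi : forall s, exists p, exists k a, on_path L v t s k a p).
{ intros s. destruct (on_path_exists L v t t_step s) as [k [a [p H]]]. eauto. }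
destruct (functional_choice _ Hxi) as [xi xi_path]. clear Hxi.
exists xi. split; [split|].
- assert (Hle : forall s s', s <= s' -> dist (xi s) (xi s') <= 40 * L * (s' - s)).
  { intros s s' Hs. destruct (xi_path s) as [k [a Hp]], (xi_path s') as [m [b Hq]].
    pose proof (on_path_lipschitz L v t hL w_adj t_step _ _ _ _ _ _ _ _ Hp Hq Hs). nra. }
  intros s s' _ _. destruct (Rle_dec s s') as [Hs|Hs].
  + rewrite Rabs_minus_sym, Rabs_pos_eq by lra. now apply Hle.
  + rewrite dist_sym, Rabs_pos_eq by lra. apply Hle. lra.
- assert (Hge : forall s s', s <= s' -> / (40 * L) * (s' - s) <= dist (xi s) (xi s')).
  { intros s s' Hs. destruct (xi_path s) as [k [a Hp]], (xi_path s') as [m [b Hq]].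
    pose proof (on_path_expanding L v t hL w_adj w_inj t_step t_dist
      _ _ _ _ _ _ _ _ Hp Hq Hs) as H.
    apply (Rmult_le_reg_l (40 * L)); [lra|].
    rewrite <- Rmult_assoc, Rinv_r, Rmult_1_l by lra.
    pose proof (norm_ge_0 (minus (xi s) (xi s'))). nra. }
  intros s s' _ _. destruct (Rle_dec s s') as [Hs|Hs].
  + rewrite Rabs_minus_sym, Rabs_pos_eq by lra. now apply Hge.
  + rewrite dist_sym, Rabs_pos_eq by lra. apply Hge. lra.
- apply Lub_Rbar_correct. intros d [s ->]. simpl.
  destruct (xi_path s) as [k [a Hp]].
  pose proof (on_path_start L v t hL w_adj _ _ _ _ Hp) as Ds.
  pose proof (on_path_end L v t hL w_adj _ _ _ _ Hp) as De.
  pose proof (gap_le L v t hL w_adj t_dist k) as G.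
  destruct Hp as [Ha [Es _]].
  pose proof (lattice_walk_close L gamma (w k) ltac:(lra) hgamma) as C0.
  pose proof (lattice_walk_close L gamma (w (k + 1)%Z) ltac:(lra) hgamma) as C1.
  fold u in C0, C1. change (u (w k)) with (v k) in C0.
  change (u (w (k + 1)%Z)) with (v (k + 1)%Z) in C1.
  change (IZR (w k) / 2) with (t k) in C0.
  change (IZR (w (k + 1)%Z) / 2) with (t (k + 1)%Z) in C1.
  pose proof (t_step k) as Gk.
  assert (B0 : t k <= s) by (subst s; nra).
  assert (B1 : s <= t (k + 1)%Z) by (subst s; nra).
  pose proof (hgamma s (t k) I I) as L0. rewrite Rabs_pos_eq in L0 by lra.
  pose proof (hgamma s (t (k + 1)%Z) I I) as L1.
  rewrite Rabs_minus_sym, Rabs_pos_eq in L1 by lra.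
  rewrite dist_sym in C0, C1, De.
  pose proof (dist_triangle (gamma s) (gamma (t k)) (xi s)) as T1.
  pose proof (dist_triangle (gamma (t k)) (lattice_point L (v k)) (xi s)) as T2.
  pose proof (dist_triangle (gamma s) (gamma (t (k + 1)%Z)) (xi s)) as T3.
  pose proof (dist_triangle (gamma (t (k + 1)%Z)) (lattice_point L (v (k + 1)%Z)) (xi s)) as T4.
  (* The sum of the estimates through the two endpoints of the edge at time [s]. *)
  assert (H : 2 * dist (gamma s) (xi s) <= 7 * L + L * (t (k + 1)%Z - t k)) by lra.
  apply (Rmult_le_compat_l L) in G; [|lra].
  assert (L2 : L <= L ^ 3) by nra.
  assert (L3 : L ^ 3 <= L ^ 5).
  { apply Rle_pow; [exact hL|lia]. }
  change (dist (gamma s) (xi s) <= 8 * L ^ 5).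
  nra.
Qed.
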